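(* Let $X_1,\dots,X_n$ be the observations, with empirical distribution function $\mathbb{F}_n$. Suppose $\widehat g_n^0=e^{\widehat\psi_n^0}\in\mathcal{SLC}_0$ and let $\widehat G_n^0(x)=\int_{-\infty}^x\widehat g_n^0(y)\,dy$. Then $\widehat g_n^0$ is the maximum likelihood estimator over $\mathcal{SLC}_0$ if and only if $$\int\Delta\,d\mathbb{F}_n\le\int\Delta\,d\widehat G_n^0$$ for all $\Delta$ such that $\widehat\psi_n^0+t\Delta\in\mathcal{SC}_0$ for some $t>0$.
   Context: $X_1,\dots,X_n$ are i.i.d. from a density on $\mathbb{R}$ and $\mathbb{F}_n(x)=n^{-1}\sum_{i=1}^n 1_{(-\infty,x]}(X_i)$. $\mathcal{C}$ is the class of concave, closed, proper functions $\varphi:\mathbb{R}\to[-\infty,\infty)$. $\mathcal{SC}_0$ is the class of $\varphi\in\mathcal{C}$ with $\varphi(0)\ge\varphi(x)$ and $\varphi(-x)=\varphi(x)$ for all $x\in\mathbb{R}$, and $\mathcal{SLC}_0=\{e^{\varphi}:\varphi\in\mathcal{SC}_0,\ \int e^{\varphi}\,d\lambda=1\}$ with $\lambda$ Lebesgue measure. The MLE over $\mathcal{SLC}_0$ is $e^{\psi}$ where $\psi$ maximizes over $\mathcal{SC}_0$ the criterion $$\Psi_n(\varphi)=\frac1n\sum_{i=1}^n\varphi(X_i)-\int_{\mathbb{R}}e^{\varphi(x)}\,dx .$$ *)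

(* Defs.v *)
From HB Require Import structures.
From mathcomp Require Import all_boot all_order all_algebra.
From mathcomp Require Import all_classical all_reals all_analysis.
From mathcomp Require Import measurable_realfun.

Set Implicit Arguments.
Unset Strict Implicit.
Unset Printing Implicit Defensive.

Import Order.TTheory GRing.Theory Num.Theory.
Import numFieldNormedType.Exports.

Local Open Scope classical_set_scope.
Local Open Scope ring_scope.

Section sampling_model.
Context d (T : measurableType d) (R : realType) (P : probability T R).
Context (n : nat).

Definition mutually_independent (X : 'I_n -> {RV P >-> R}) :=
  forall (J : {set 'I_n}) (B : 'I_n -> set R), (forall i, measurable (B i)) ->
    P (\bigcap_(i in [set` J]) (X i @^-1` B i)) =
    (\prod_(i in J) P (X i @^-1` B i))%E.

Definition has_density (X : {RV P >-> R}) (f : R -> R) :=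
  [/\ measurable_fun [set: R] f, forall y, 0 <= f y &
      forall A : set R, measurable A ->
        distribution P X A = (\int[lebesgue_measure]_(y in A) (f y)%:E)%E].

(* Independent with one common density, hence identically distributed. *)
Definition iid_with_density (X : 'I_n -> {RV P >-> R}) (f : R -> R) :=
  mutually_independent X /\ forall i, has_density (X i) f.

End sampling_model.

Section concave_classes.
Context (R : realType).
Implicit Types phi : R -> \bar R.
Local Open Scope ereal_scope.

(* Since phi never takes the value +oo, the left-hand side contains no
   +oo - oo; for t = 0 or 1 the convention 0 * -oo = 0 makes it trivial. *)
Definition concave phi := forall (x y t : R), (0 <= t <= 1)%R ->
  t%:E * phi x + (1 - t)%:E * phi y <= phi (t * x + (1 - t) * y)%R.

(* For a proper concave function, closed means upper semicontinuous. *)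
Definition closed_concave phi := lower_semicontinuous (fun x => - phi x).

Definition C : set (R -> \bar R) := [set phi |
  [/\ concave phi, closed_concave phi, exists x, -oo < phi x &
      forall x, phi x < +oo]].

Definition SC0 : set (R -> \bar R) := [set phi |
  [/\ C phi, forall x, phi x <= phi 0%R & forall x, phi (- x)%R = phi x]].

Definition SLC0 : set (R -> \bar R) :=
  [set (fun x => expeR (phi x)) | phi in
     [set phi | SC0 phi /\ \int[lebesgue_measure]_x expeR (phi x) = 1]].

End concave_classes.

Section mle.
Context (R : realType) (n : nat).
Implicit Types (X : 'I_n -> R) (phi : R -> \bar R).
Local Open Scope ereal_scope.

Definition Psi X phi : \bar R :=
  (n%:R^-1)%:E * \sum_(i < n) phi (X i)
  - \int[lebesgue_measure]_x expeR (phi x).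

Definition is_MLE0 X (g : R -> \bar R) := exists psi,
  [/\ SC0 psi, forall phi, SC0 phi -> Psi X phi <= Psi X psi &
      g = fun x => expeR (psi x)].

End mle.

Section empirical_distribution_function.
Context (R : realType) (n : nat) (X : 'I_n -> R).

Definition edf (x : R) : R := n%:R^-1 * \sum_(i < n) \1_(`]-oo, x]) (X i).

Let edf_nd : nondecreasing edf.
Proof.
move=> x y xy; rewrite /edf ler_wpM2l ?invr_ge0//.
apply: ler_sum => i _; rewrite !indicE ler_nat !mem_setE !in_itv/=.
by case: (leP (X i) x) => // Xx; rewrite (le_trans Xx).
Qed.

Let edf_rc : right_continuous edf.
Proof.
move=> a; rewrite /edf; apply: cvgM; first exact: cvg_cst.
apply: cvg_big => [|i _]; first exact: add_continuous.
rewrite !indicE mem_setE in_itv/=.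
have [Xa|aX] := leP (X i) a; apply: cvg_near_cst.
  near=> x; rewrite indicE mem_setE in_itv/=.
  have ax : a < x by near: x; exact: nbhs_right_gt.
  by rewrite (le_trans Xa (ltW ax)).
near=> x; rewrite indicE mem_setE in_itv/= leNgt.
by have -> : x < X i by near: x; exact: nbhs_right_lt.
Unshelve. all: by end_near. Qed.

HB.instance Definition _ := isCumulative.Build R _ R edf edf_nd edf_rc.

End empirical_distribution_function.

Section distribution_function_of_SLC0.
Context (R : realType) (g : R -> \bar R) (hg : SLC0 g).
Local Notation leb := (@lebesgue_measure R).

(* The unused argument hg makes the Cumulative instance below inferable. *)
Definition slc0_df of SLC0 g := fun x : R =>
  fine (\int[leb]_(y in `]-oo, x]) g y)%E.

Let g_ge0 y : (0 <= g y)%E.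
Proof. by case: hg => phi _ <-; exact: expeR_ge0. Qed.

Let int_g : (\int[leb]_y g y)%E = 1%E.
Proof. by case: hg => phi [_ phi1] <-. Qed.

Let measurable_g : measurable_fun [set: R] g.
Proof.
case: hg => phi [[[_ phic _ _] _ _] _] <-.
rewrite (_ : (fun _ => _) = (fun y => - (- expeR (phi y)))%E); last first.
  by apply/funext => y; rewrite oppeK.
apply: measurableT_comp => //; apply: lower_semicontinuous_measurable.
apply/lower_semicontinuousP => a.
have [a0|a0] := ltP a 0; last first.
  rewrite (_ : [set _ | _] = set0); first exact: open0.
  apply/seteqP; split => // y /=; rewrite ltNge => /negP; apply.
  by rewrite (@le_trans _ _ 0%E) ?lee_fin// leeNl oppe0 expeR_ge0.
move/lower_semicontinuousP : phic => /(_ (- ln (- a))).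
congr open; apply/seteqP.
split => y /= h.
  rewrite lteNr -EFinN; move: h; rewrite lteNr -EFinN opprK -lte_expeR/=.
  by rewrite lnK// posrE oppr_gt0.
rewrite lteNr -EFinN opprK -lte_expeR/= lnK ?posrE ?oppr_gt0//.
by rewrite EFinN lteNr.
Qed.

Let nu (A : set (measurableTypeR R)) : \bar R := (\int[leb]_(y in A) g y)%E.

Let nu0 : nu set0 = 0%E.
Proof. exact: integral_set0. Qed.

Let nu_ge0 A : (0 <= nu A)%E.
Proof. exact: integral_ge0. Qed.

Let nu_sigma_additive : semi_sigma_additive nu.
Proof. exact: semi_sigma_additive_nng_induced. Qed.

#[local] HB.instance Definition _ :=
  isMeasure.Build _ _ _ nu nu0 nu_ge0 nu_sigma_additive.
#[local] HB.instance Definition _ :=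
  Measure_isProbability.Build _ _ _ nu int_g.

Let idTR : measurableTypeR R -> R := idfun.

#[local] HB.instance Definition _ :=
  @isMeasurableFun.Build _ _ _ _ idTR (@measurable_id _ _ setT).

Let slc0_dfE x : slc0_df hg x = fine (cdf (idTR : {RV nu >-> R}) x).
Proof. by []. Qed.

Let slc0_df_nd : nondecreasing (slc0_df hg).
Proof.
by move=> x y xy; rewrite !slc0_dfE fine_le ?fin_num_measure// cdf_nondecreasing.
Qed.

Let slc0_df_rc : right_continuous (slc0_df hg).
Proof.
move=> a; apply: fine_cvg.
rewrite slc0_dfE fineK ?fin_num_measure//.
exact: (@cdf_right_continuous _ _ _ _ (idTR : {RV nu >-> R})).
Qed.

HB.instance Definition _ :=
  isCumulative.Build R _ R (slc0_df hg) slc0_df_nd slc0_df_rc.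

End distribution_function_of_SLC0.

(* Main.v *)
From HB Require Import structures.
Require Import Defs.
From mathcomp Require Import all_boot all_order all_algebra.
From mathcomp Require Import all_classical all_reals all_analysis.
From mathcomp Require Import measurable_realfun.
From mathcomp Require Import ring lra.

Set Implicit Arguments.
Unset Strict Implicit.
Unset Printing Implicit Defensive.

Import Order.TTheory GRing.Theory Num.Theory.
Import numFieldNormedType.Exports.

Local Open Scope classical_set_scope.
Local Open Scope ring_scope.

(** The criterion is concave along segments, so its maximizers are the points
    where no directional derivative is positive. Write [Fn] for the empirical
    measure and [G] for the measure with density [expeR psi]. Since
    [expeR (psi + s * Delta)] is [expeR (s * Delta)] times that density, the
    increment of the criterion in the direction [Delta] is
    [s * \int Delta dFn - (\int expeR (s * Delta) dG - 1)].

    If the inequality holds for all directions and [phi] is a competitor, take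
    [Delta = phi - psi]; by [1 + x <= exp x] the increment up to [phi] is at
    most [\int Delta dFn - \int Delta dG <= 0] ([MLE_sufficient]).

    If [psi] is a maximizer, then
    [\int Delta dFn <= \int (expeR (s * Delta) - 1) / s dG] for small [s > 0],
    and the integrand decreases to [Delta] as [s] decreases to 0. Monotone
    convergence gives the inequality, also when [\int Delta dG = -oo]
    ([exp_moment_derivative], [MLE_necessary]), provided that one of these
    integrals is finite; this holds because [expeR (psi / 2)] is integrable
    ([SC0_integral_half]).

    The value [-oo] requires care. Observations outside the effective domain of
    [psi] are excluded on both sides: they make the criterion [-oo]
    ([MLE_finite]), and they make the indicator of the complement of that domain
    violate the inequality. On this complement a direction may be any function,
    even non measurable, but both measures vanish there, and integrals ignore
    null sets ([integral_conull]). *)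

(** * Null sets and densities *)

Section integral_on_conull_set.
Local Open Scope ereal_scope.
Context d (T : measurableType d) (R : realType).
Variable mu : {measure set T -> \bar R}.
Import HBNNSimple.

(* A simple function below f stays below f, with the same integral, once it
   is cut off outside D: no measurability of f enters the supremum. *)
Let ge0_integral_conull (D : set T) (f : T -> \bar R) :
  measurable D -> mu (~` D) = 0 -> (forall x, 0 <= f x) ->
  \int[mu]_x f x = \int[mu]_x (f \_ D) x.
Proof.
move=> mD D0 f0.
have fD0 x : 0 <= (f \_ D) x by rewrite patchE; case: ifP.
rewrite !ge0_integralTE//; apply/eqP; rewrite eq_le; apply/andP; split.
  apply: ge_ereal_sup => _ [h /= hf <-].
  apply: le_ereal_sup_tmp.
  exists (sintegral mu (mul_nnsfun h (indic_nnsfun R mD))); last first.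
    rewrite -!integralT_nnsfun.
    rewrite (@ge0_ae_eq_integral _ _ _ mu setT _
      (fun x => (mul_nnsfun h (indic_nnsfun R mD) x)%:E))//.
    - exact/measurable_EFinP/measurable_funP.
    - exact/measurable_EFinP/measurable_funP.
    - by move=> x _; rewrite lee_fin.
    - by move=> x _; rewrite lee_fin.
    - exists (~` D); split => //; first exact: measurableC.
      move=> x /=; apply: contra_not => Dx _; congr EFin.
      by rewrite /= /indic_nnsfun /= /mindic indicE mem_set// mulr1.
  exists (mul_nnsfun h (indic_nnsfun R mD)) => //= x.
  rewrite patchE /indic_nnsfun /= /mindic indicE; case: ifPn => _.
    by rewrite mulr1.
  by rewrite mulr0.
apply: ge_ereal_sup => _ [h /= hf <-]; apply: ereal_sup_ubound.
exists h => //= x; apply: (le_trans (hf x)).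
by rewrite patchE; case: ifP.
Qed.

(** The integral of a function that need not be measurable is a difference of
    suprema over simple functions, and it still ignores null sets. A direction
    [Delta] is arbitrary where [psi = -oo], so this is what allows replacing it
    by a measurable function. *)
Lemma integral_conull (D : set T) (f : T -> \bar R) :
  measurable D -> mu (~` D) = 0 -> \int[mu]_x f x = \int[mu]_x (f \_ D) x.
Proof.
move=> mD D0; rewrite integralE [in RHS]integralE.
by rewrite funepos_restrict funeneg_restrict -!ge0_integral_conull.
Qed.

End integral_on_conull_set.

Section density.
Local Open Scope ereal_scope.
Context d (T : measurableType d) (R : realType).
Variables (mu nu : {measure set T -> \bar R}) (g : T -> \bar R).
Hypotheses (mg : measurable_fun setT g) (g0 : forall x, 0 <= g x).
Hypothesis gfin : forall x, g x \is a fin_num.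
Hypothesis nuE : forall A, measurable A -> nu A = \int[mu]_(x in A) g x.
Import HBNNSimple.

Lemma ge0_integral_density (f : T -> \bar R) :
  measurable_fun setT f -> (forall x, 0 <= f x) ->
  \int[nu]_x f x = \int[mu]_x (f x * g x).
Proof.
move=> mf f0; have mT := @measurableT _ T; pose f_ := nnsfun_approx mT mf.
have mf_ n : measurable_fun setT (fun x => (f_ n x)%:E).
  exact/measurable_EFinP/measurable_funP.
have nd_f x m n : (m <= n)%N -> (f_ m x <= f_ n x)%R.
  by move=> mn; exact/lefP/nd_nnsfun_approx.
transitivity (limn (fun n => \int[nu]_x (f_ n x)%:E)).
  rewrite -monotone_convergence//.
  - apply: eq_integral => x _; apply/esym/cvg_lim => //.
    exact: cvg_nnsfun_approx.
  - by move=> n x _; rewrite lee_fin.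
  - by move=> x _ m n mn; rewrite lee_fin nd_f.
transitivity (limn (fun n => \int[mu]_x ((f_ n x)%:E * g x))); last first.
  rewrite -monotone_convergence//.
  - apply: eq_integral => x _; apply/cvg_lim => //.
    by apply: cvgeZr => //; exact: cvg_nnsfun_approx.
  - by move=> n; exact: emeasurable_funM.
  - by move=> n x _; rewrite mule_ge0// lee_fin.
  - by move=> x _ m n mn; rewrite lee_wpmul2r// lee_fin nd_f.
congr (limn _); apply/funext => n.
transitivity (\sum_(r \in range (f_ n)) r%:E * nu (f_ n @^-1` [set r])).
  by rewrite integralT_nnsfun sintegralE.
transitivity (\int[mu]_x
  \sum_(r \in range (f_ n)) (r * \1_(f_ n @^-1` [set r]) x)%:E * g x).
  rewrite ge0_integral_fsum//; last 2 first.
  - move=> r; apply: emeasurable_funM => //.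
    exact/measurable_EFinP/measurable_funM.
  - by move=> r x _; rewrite mule_ge0// nnfun_muleindic_ge0.
  apply: eq_fsbigr => r /set_mem[x _ <-].
  rewrite nuE//.
  rewrite [RHS](_ : _ = \int[mu]_y
      ((f_ n x)%:E * (g \_ (f_ n @^-1` [set f_ n x])) y)).
    rewrite ge0_integralZl//; first by rewrite -integral_mkcond.
    - by apply: (measurable_restrictT g _).1 => //; exact: measurable_funTS.
    - by move=> y _; rewrite patchE; case: ifP.
    - by rewrite lee_fin.
  apply: eq_integral => y _; rewrite patchE indicE EFinM -muleA.
  by case: ifPn => _; rewrite ?mul1e ?mul0e.
apply: eq_integral => x _.
rewrite -ge0_mule_fsuml; last by move=> r; rewrite nnfun_muleindic_ge0.
by rewrite fsumEFin// -fimfunE.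
Qed.

End density.

(** * Integrals of a function and of its exponential *)

Lemma measurable_expeR (R : realType) : measurable_fun [set: \bar R] (@expeR R).
Proof.
rewrite (_ : @expeR R = fun x => if x == +oo%E then +oo%E else
    if x == -oo%E then 0%E else (expR (fine x))%:E); last first.
  by apply/funext => -[].
apply: measurable_fun_ifT => //=; first exact: measurable_fun_eqe.
apply: measurable_fun_ifT => //=; first exact: measurable_fun_eqe.
apply/measurable_EFinP => //=.
exact: (@measurableT_comp _ _ _ _ _ _ (@expR R)).
Qed.

Section exponential_moments.
Local Open Scope ereal_scope.
Context d (T : measurableType d) (R : realType).
Variable nu : {measure set T -> \bar R}.

(** Monotonicity without integrability: positive parts grow, negative parts
    shrink, and the convention for [+oo - oo] respects this. *)
Lemma integral_le_pointwise (f h : T -> \bar R) :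
  measurable_fun setT f -> measurable_fun setT h ->
  (forall x, f x <= h x) -> \int[nu]_x f x <= \int[nu]_x h x.
Proof.
move=> mf mh fh; rewrite integralE [leRHS]integralE leeB//.
- apply: ge0_le_integral => //; [exact: measurable_funepos..|].
  by move=> x _; apply: (@funepos_le _ _ setT); rewrite ?inE// => ? _.
- apply: ge0_le_integral => //; [exact: measurable_funeneg..|].
  by move=> x _; apply: (@funeneg_le _ _ setT); rewrite ?inE// => ? _.
Qed.

Hypothesis nuT : nu setT = 1.

(** Integrated form of the tangent inequality [1 + x <= exp x]; the right-hand
    side may be infinite, and so may the left-hand side be [-oo]. *)
Lemma integral_le_expeR (Delta : T -> \bar R) :
  measurable_fun setT Delta ->
  \int[nu]_x Delta x <= \int[nu]_x expeR (Delta x) - 1.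
Proof.
move=> mD.
have mE : measurable_fun setT (fun x => expeR (Delta x)).
  exact: measurableT_comp (@measurable_expeR R) mD.
have [Ioo|Ioo] := eqVneq (\int[nu]_x expeR (Delta x)) +oo.
  by rewrite Ioo addye// leey.
have int1 : nu.-integrable setT (cst (1 : \bar R)).
  apply/integrableP; split => //.
  under eq_integral do rewrite /= normr1.
  by rewrite integral_cst// nuT mule1 ltry.
have intE : nu.-integrable setT (fun x => expeR (Delta x)).
  apply/integrableP; split => //.
  under eq_integral do rewrite gee0_abs ?expeR_ge0//.
  by rewrite ltey.
rewrite [X in _ <= _ - X](_ : _ = \int[nu]_x cst 1 x); last first.
  by rewrite integral_cst// nuT mule1.
rewrite -integralB//; apply: integral_le_pointwise => //.
  by apply: emeasurable_funB => //.
move=> x; change (Delta x <= expeR (Delta x) - 1).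
by rewrite leeBrDr// addeC expeR_ge1Dx.
Qed.

Section derivative_at_zero.
Variables (Delta : T -> \bar R) (s0 delta : R).
Hypotheses (mD : measurable_fun setT Delta) (Dfin : forall x, Delta x < +oo).
Hypotheses (s0_gt0 : (0 < s0)%R).
Hypothesis s0fin : \int[nu]_x expeR (s0%:E * Delta x) < +oo.
Hypothesis ge_delta : forall s : R, (0 < s <= s0)%R ->
  1 + (s * delta)%:E <= \int[nu]_x expeR (s%:E * Delta x).

(* Real-valued because Delta < +oo and s > 0; it vanishes where Delta = -oo. *)
Let e (s : R) x : R := fine (expeR (s%:E * Delta x)).

Let e_ge0 s x : (0 <= e s x)%R.
Proof. by rewrite fine_ge0// expeR_ge0. Qed.

Let eE s x : (0 < s)%R -> (e s x)%:E = expeR (s%:E * Delta x).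
Proof.
move=> s_gt0; rewrite fineK// /expeR; case: (Delta x) (Dfin x) => [r| |]//= _.
by rewrite gt0_muleNy.
Qed.

Let e_half s x : (0 < s)%R -> e s x = (e (s / 2) x ^+ 2)%R.
Proof.
move=> s_gt0; apply: EFin_inj; rewrite expr2 EFinM !eE ?divr_gt0// -expeRD.
congr expeR; rewrite -ge0_muleDl; first by rewrite -EFinD -splitr.
- by rewrite lee_fin divr_ge0// ltW.
- by rewrite lee_fin divr_ge0// ltW.
Qed.

Let dq (s : R) x : R := ((e s x - 1) / s)%R.

(* With y = e (s / 2) x, the difference of the two sides is (y - 1)^2 / s;
   this is the monotonicity of difference quotients of the exponential, along
   halving of the step. *)
Let dq_half s x : (0 < s)%R -> (dq (s / 2) x <= dq s x)%R.
Proof.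
move=> s_gt0; rewrite /dq (e_half x s_gt0) invf_div mulrA.
rewrite ler_pdivlMr// divfK ?gt_eqF//.
by have := sqr_ge0 (e (s / 2) x - 1)%R; nra.
Qed.

Let sk k : R := (s0 / 2 ^+ k)%R.

Let skS k : sk k.+1 = (sk k / 2)%R.
Proof. by rewrite /sk exprSr invfM mulrA. Qed.

Let sk_gt0 k : (0 < sk k)%R.
Proof. by rewrite divr_gt0// exprn_gt0. Qed.

Let sk_le k : (sk k <= s0)%R.
Proof. by rewrite ler_pdivrMr ?exprn_gt0// ler_pMr// exprn_ege1// ler1n. Qed.

Let cvg_sk : sk @ \oo --> (0 : R)%R.
Proof.
rewrite /sk; under eq_fun do rewrite -exprVn.
by apply: cvg_geometric; rewrite ger0_norm ?invf_lt1 ?ltr1n.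
Qed.

Let me s : measurable_fun setT (e s).
Proof.
apply: (measurableT_comp (f := fine)); first exact: fine_measurable.
apply: (measurableT_comp (f := @expeR R)); first exact: measurable_expeR.
exact: measurable_funeM.
Qed.

Let mdq s : measurable_fun setT (dq s).
Proof. by apply: measurable_funM => //; exact: measurable_funB. Qed.

Let int1 : nu.-integrable setT (EFin \o cst (1%R : R)).
Proof.
apply/integrableP; split; first by apply/measurable_EFinP.
under eq_integral do rewrite /= normr1.
by rewrite integral_cst// nuT mule1 ltry.
Qed.

Let int_e k : nu.-integrable setT (EFin \o e (sk k)).
Proof.
elim: k => [|k ih].
  rewrite /sk expr0 divr1; apply/integrableP; split; first exact/measurable_EFinP.
  under eq_integral do rewrite /= ger0_norm// eE//.
  exact: s0fin.
apply: (@le_integrable _ _ _ nu setT _ _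
    (fun x => (EFin \o cst (1%R : R)) x + (EFin \o e (sk k)) x)) => //=.
- exact/measurable_EFinP.
- move=> x _; rewrite lee_fin !ger0_norm ?addr_ge0// (e_half x (sk_gt0 k)) -skS.
  (* y <= 1 + y^2 *)
  by have := sqr_ge0 (e (sk k.+1) x - 2^-1)%R; nra.
- exact: (@integrableD _ _ _ nu setT _ _ _ int1 ih).
Qed.

Let int_dq k : nu.-integrable setT (EFin \o dq (sk k)).
Proof.
rewrite (_ : _ \o _ = fun x => ((sk k)^-1)%:E *
    ((EFin \o e (sk k)) x - (EFin \o cst 1%R) x)); last first.
  by apply/funext => x /=; rewrite /dq mulrC.
apply: integrableZl => //; apply: integrableB => //.
Qed.

Let integral_dq k :
  \int[nu]_x (dq (sk k) x)%:E =
  ((sk k)^-1)%:E * (\int[nu]_x (e (sk k) x)%:E - 1).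
Proof.
under eq_integral do rewrite /dq mulrC EFinM EFinB.
rewrite (integralZl measurableT (integrableB measurableT (int_e k) int1)).
congr (_ * _); rewrite (@integralB_EFin _ _ _ nu setT _ (cst 1%R))//.
by rewrite -[X in _ - X = _]/(\int[nu]_x cst 1 x) integral_cst// nuT mule1.
Qed.

Let delta_le k : delta%:E <= \int[nu]_x (dq (sk k) x)%:E.
Proof.
rewrite integral_dq -lee_pdivrMl ?invr_gt0// invrK leeBrDr// addeC.
under eq_integral do rewrite eE//.
by apply: ge_delta; rewrite sk_gt0 sk_le.
Qed.

(* For a finite value r, r <= (exp (s r) - 1) / s <= r exp (s r); for the
   value -oo the quotient is -1 / s. *)
Let dq_cvg x : (dq (sk k) x)%:E @[k --> \oo] --> Delta x.
Proof.
rewrite /dq /e; case: (Delta x) (Dfin x) => [r _| |_]//=.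
- apply: cvg_EFin; first exact: nearW.
  have h : (r * expR (sk k * r) @[k --> \oo] --> r)%R.
    rewrite -[X in _ --> X]mulr1; apply: cvgMr.
    rewrite -expR0 -(mul0r r).
    apply: continuous_cvg; [exact: continuous_expR|exact: cvgMl].
  apply: (squeeze_cvgr _ _ h); last exact: cvg_cst.
  apply: nearW => k /=; apply/andP; split.
    rewrite ler_pdivlMr// mulrC lerBrDl; exact: expR_ge1Dx.
  rewrite ler_pdivrMr//.
  have := expR_ge1Dx (- (sk k * r))%R.
  rewrite expRN -(ler_pM2r (expR_gt0 (sk k * r))) mulVf ?gt_eqF ?expR_gt0//.
  by nra.
- have -> : (fun k => ((fine (expeR ((sk k)%:E * -oo)) - 1) / sk k)%R%:E) =
      (fun k => - (((s0)^-1 * 2 ^+ k)%R)%:E).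
    apply/funext => k; rewrite gt0_muleNy ?lte_fin//.
    have -> : fine (expeR (-oo : \bar R)) = 0%R by [].
    by rewrite sub0r mulN1r EFinN /sk invf_div mulrC.
  rewrite -[-oo]/(- +oo); apply: cvgeN; apply/cvgeryP.
  apply/cvgryPge => A; have /cvgryPge/(_ (s0 * A)%R) := @cvgr_idn R.
  apply: filterS => k sAk; rewrite ler_pdivlMl//; apply: (le_trans sAk).
  by rewrite -natrX ler_nat ltnW// ltn_expl.
Qed.

(** The derivative at 0 of [s |-> \int expeR (s * Delta)] is [\int Delta], also
    when the latter is [-oo]: along the steps [s0 / 2 ^ k] the difference
    quotients decrease to [Delta], so monotone convergence applies to their
    distance to the first one, which is integrable. *)
Lemma exp_moment_derivative : delta%:E <= \int[nu]_x Delta x.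
Proof.
pose U k x := (dq s0 x - dq (sk k) x)%R.
have sk0 : sk 0%N = s0 by rewrite /sk expr0 divr1.
have nd_dq k x : (dq (sk k.+1) x <= dq (sk k) x)%R by rewrite skS dq_half.
have nd_dqm x m k : (m <= k)%N -> (- dq (sk m) x <= - dq (sk k) x)%R.
  move=> /subnK <-; elim: (k - m)%N => // j ih.
  by rewrite addSn (le_trans ih)// lerN2.
have U0 k x : (0 <= U k x)%R.
  by rewrite subr_ge0 -lerN2 -{1}sk0 nd_dqm.
have mU k : measurable_fun setT (fun x => (U k x)%:E).
  by apply/measurable_EFinP; exact: measurable_funB.
pose h x := (dq s0 x)%:E - Delta x.
have U_cvg x : (U k x)%:E @[k --> \oo] --> h x.
  rewrite /h /U; under eq_fun do rewrite EFinB.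
  apply: cvgeB; [exact: fin_num_adde_defr|exact: cvg_cst|exact: dq_cvg].
have hE : \int[nu]_x h x = limn (fun k => \int[nu]_x (U k x)%:E).
  rewrite -monotone_convergence//.
  - by apply: eq_integral => x _; apply/esym/cvg_lim => //; exact: U_cvg.
  - by move=> k x _; rewrite lee_fin.
  - by move=> x _ m k mk; rewrite lee_fin lerD2l nd_dqm.
have int0 : nu.-integrable setT (EFin \o dq s0) by rewrite -sk0.
have h_ge0 x : 0 <= h x.
  rewrite -(cvg_lim _ (U_cvg x))//; apply: lime_ge.
    by apply/cvg_ex; exists (h x); exact: U_cvg.
  by apply: nearW => k; rewrite lee_fin.
have mh : measurable_fun setT h.
  by apply: emeasurable_funB => //; exact/measurable_EFinP.
have IU k : \int[nu]_x (U k x)%:E <= \int[nu]_x (dq s0 x)%:E - delta%:E.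
  rewrite (@integralB_EFin _ _ _ nu setT _ (dq (sk k)))//.
  by rewrite leeB.
have hle : \int[nu]_x h x <= \int[nu]_x (dq s0 x)%:E - delta%:E.
  rewrite hE; apply: lime_le; last exact: nearW.
  apply: ereal_nondecreasing_is_cvgn => m k mk; apply: ge0_le_integral => //.
  - by move=> x _; rewrite lee_fin.
  - by move=> x _; rewrite lee_fin lerD2l nd_dqm.
have fdq : \int[nu]_x (dq s0 x)%:E \is a fin_num by exact: integrable_fin_num.
have hint : nu.-integrable setT h.
  apply/integrableP; split => //.
  under eq_integral do rewrite gee0_abs//.
  by apply: (le_lt_trans hle); rewrite ltey_eq fin_numB fdq.
rewrite (eq_integral (fun x => (dq s0 x)%:E - h x)); last first.
  move=> x _; rewrite /h; case: (Delta x) (Dfin x) => [r| |]//= _.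
  by rewrite -!EFinB opprB addrCA subrr addr0.
rewrite (integralB measurableT int0 hint).
by rewrite leeBrDr ?integrable_fin_num// addeC -leeBrDr.
Qed.

End derivative_at_zero.
End exponential_moments.

(** * Concave symmetric functions *)

Section semicontinuity.
Local Open Scope ereal_scope.
Context (X : topologicalType) (R : realType).
Implicit Types f g : X -> \bar R.

Lemma lte_adde_split (a : R) (u v : \bar R) : -oo < u -> -oo < v ->
  a%:E < u + v -> exists b c : R, [/\ b%:E < u, c%:E < v & a = (b + c)%R].
Proof.
case: u => [r| |]// _; case: v => [s| |]// _.
- rewrite -EFinD lte_fin => ars.
  exists (r - (r + s - a) / 2)%R, (s - (r + s - a) / 2)%R.
  by rewrite !lte_fin; split; lra.
- by exists (r - 1)%R, (a - (r - 1))%R; rewrite !lte_fin !ltry; split => //; lra.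
- by exists (a - (s - 1))%R, (s - 1)%R; rewrite !lte_fin !ltry; split => //; lra.
- by exists a, 0%R; rewrite !ltry; split => //; rewrite addr0.
Qed.

Lemma lower_semicontinuousD f g :
  (forall x, -oo < f x) -> (forall x, -oo < g x) ->
  lower_semicontinuous f -> lower_semicontinuous g ->
  lower_semicontinuous (fun x => f x + g x).
Proof.
move=> f0 g0 lf lg x a /(lte_adde_split (f0 x) (g0 x))[b [c [bf cg ->]]].
have [V xV Vf] := lf _ _ bf; have [W xW Wg] := lg _ _ cg.
exists (V `&` W); first exact: filterI.
by move=> y [/Vf bfy /Wg cgy]; rewrite EFinD lteD.
Qed.

Lemma lower_semicontinuousZ (k : R) f : (0 < k)%R ->
  lower_semicontinuous f -> lower_semicontinuous (fun x => k%:E * f x).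
Proof.
move=> k0 lf x a; rewrite -lte_pdivrMl// => /(lf x)[V xV Vf].
by exists V => // y /Vf; rewrite -lte_pdivrMl.
Qed.

End semicontinuity.

Section symmetric_concave.
Local Open Scope ereal_scope.
Context (R : realType).
Implicit Types phi chi psi : R -> \bar R.

Lemma SC0_lty phi x : SC0 phi -> phi x < +oo.
Proof. by case=> -[_ _ _]. Qed.

Lemma SC0_fin0 phi : SC0 phi -> phi 0%R \is a fin_num.
Proof.
move=> [[_ _ [x phix] phioo] phi0 _].
by rewrite fin_numE -ltNye -ltey phioo andbT (lt_le_trans phix).
Qed.

Lemma SC0_measurable phi : SC0 phi -> measurable_fun setT phi.
Proof.
move=> [[_ phic _ _] _ _].
rewrite (_ : phi = fun x => - (- phi x)); last first.
  by apply/funext=> x; rewrite oppeK.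
by apply: measurableT_comp => //; exact: lower_semicontinuous_measurable.
Qed.

Lemma SC0_measurable_Ny phi : SC0 phi -> measurable [set x | phi x = -oo].
Proof.
move=> /SC0_measurable mphi; rewrite -[X in measurable X]setTI.
by apply: (mphi measurableT [set -oo]); exact: emeasurable_set1.
Qed.

Lemma expeR_SC0_measurable phi : SC0 phi ->
  measurable_fun setT (fun x => expeR (phi x)).
Proof.
move=> Sphi; apply: measurableT_comp (SC0_measurable Sphi).
exact: measurable_expeR.
Qed.

Lemma pmule_lty (r : R) (u : \bar R) : (0 <= r)%R -> u < +oo -> r%:E * u < +oo.
Proof.
rewrite le_eqVlt => /predU1P[<-|r0]; first by rewrite mul0e ltry.
by case: u => [s| |]//= _; rewrite ?gt0_muleNy ?lte_fin// -EFinM ltry.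
Qed.

Lemma add_def_lty (u v : \bar R) : u < +oo -> v < +oo -> u +? v.
Proof. by case: u => [r| |]; case: v => [s| |]. Qed.

(** Convexity of the class. For [0 < s < 1] the mixture is [-oo] as soon as one
    of the two functions is, so that it is closed even when the effective
    domains differ. *)
Lemma SC0_mix phi chi (s : R) : (0 < s < 1)%R -> SC0 phi -> SC0 chi ->
  SC0 (fun x => (1 - s)%:E * phi x + s%:E * chi x).
Proof.
move=> /andP[s0 s1] Sphi Schi.
have s'0 : (0 < 1 - s)%R by rewrite subr_gt0.
have philt x := SC0_lty x Sphi; have chilt x := SC0_lty x Schi.
have lt1 x : (1 - s)%:E * phi x < +oo by rewrite pmule_lty// ltW.
have lt2 x : s%:E * chi x < +oo by rewrite pmule_lty// ltW.
have phi0 := SC0_fin0 Sphi; have chi0 := SC0_fin0 Schi.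
case: Sphi Schi => -[phic phil _ _] phim phis [[chic chil _ _] chim chis].
split; first split.
- move=> x y t t01; have /andP[t0 t1] := t01.
  have t'0 : (0 <= 1 - t)%R by rewrite subr_ge0.
  rewrite !muleDr ?add_def_lty//.
  rewrite addeACA !(muleCA t%:E) !(muleCA (1 - t)%:E).
  rewrite -!muleDr ?add_def_lty ?pmule_lty//.
  by apply: leeD; rewrite lee_pmul2l ?lte_fin//; [exact: phic|exact: chic].
- rewrite /closed_concave (_ : (fun x => _) =
    fun x => (1 - s)%:E * (- phi x) + s%:E * (- chi x)); last first.
    apply/funext => x; rewrite oppeD ?add_def_lty//.
    by rewrite !muleN.
  apply: lower_semicontinuousD.
  + by move=> x; rewrite muleN lteNr.
  + by move=> x; rewrite muleN lteNr.
  + exact: lower_semicontinuousZ.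
  + exact: lower_semicontinuousZ.
- by exists 0%R; rewrite -(fineK phi0) -(fineK chi0) -!EFinM -EFinD ltNyr.
- by move=> x; rewrite lte_add_pinfty.
- by move=> x; apply: leeD; rewrite lee_pmul2l ?lte_fin.
- by move=> x; rewrite phis chis.
Qed.

(** The logarithm of the indicator of a symmetric interval: a competitor with a
    finite criterion as soon as the interval contains the sample. *)
Lemma SC0_indic (M : R) : (0 <= M)%R ->
  SC0 (fun x : R => if (`|x| <= M)%R then 0 else -oo : \bar R).
Proof.
move=> M0; split; first split.
- move=> x y t /andP[t0 t1]; have t'0 : (0 <= 1 - t)%R by rewrite subr_ge0.
  have [->|t_neq0] := eqVneq t 0%R.
    by rewrite !mul0e add0e subr0 !mul1e mul0r mul1r add0r.
  have [->|t_neq1] := eqVneq t 1%R.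
    by rewrite subrr !mul0e adde0 !mul1e mul0r mul1r addr0.
  have t_gt0 : (0 < t)%R by rewrite lt_def t_neq0.
  have t'_gt0 : (0 < 1 - t)%R by rewrite subr_gt0 lt_def eq_sym t_neq1.
  case: ifPn => xM; last by rewrite gt0_muleNy ?lte_fin// addNye leNye.
  case: ifPn => yM; last by rewrite gt0_muleNy ?lte_fin// mule0 add0e leNye.
  rewrite !mule0 adde0 ifT// (le_trans (ler_normD _ _))// !normrM.
  rewrite (gtr0_norm t_gt0) (gtr0_norm t'_gt0).
  apply: (@le_trans _ _ (t * M + (1 - t) * M)%R); last by lra.
  by apply: lerD; rewrite ler_pM2l.
- apply/lower_semicontinuousP => a.
  have [a0|a0] := ltP a 0%R.
    rewrite (_ : [set _ | _] = setT); first exact: openT.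
    apply/seteqP; split => // x _ /=.
    by case: ifP; rewrite ?oppe0 ?lte_fin ?ltry.
  rewrite (_ : [set _ | _] = ~` `[(- M)%R, M]%classic).
    by rewrite openC; exact: interval_closed.
  apply/seteqP; split => x /=; rewrite in_itv/= -ler_norml; case: ifP => //.
  + by rewrite oppe0 lte_fin ltNge a0.
  + by rewrite ltry.
- by exists 0%R; rewrite normr0 M0.
- by move=> x; case: ifP.
- by move=> x; rewrite normr0 M0; case: ifP.
- by move=> x; rewrite normrN.
Qed.

Let half : measurableTypeR R -> measurableTypeR R := fun x : R => (x / 2)%R.

Let mhalf : measurable_fun setT half.
Proof. exact: measurable_funM. Qed.

Let push : {measure set (measurableTypeR R) -> \bar R} :=
  measure_function_pushforward__canonical__measure_function_Measure
    lebesgue_measure mhalf.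

Let lebesgue_measure_half (A : set R) : measurable A ->
  lebesgue_measure A = mscale ((2^-1)%:nng)%R push A.
Proof.
move=> mA; apply: lebesgue_measure_unique => //=.
move=> _ [[a b]] _ <-.
rewrite /mscale /= /pushforward/=.
rewrite (_ : _ @^-1` _ = `](2 * a)%R, (2 * b)%R]%classic).
  rewrite !lebesgue_measure_itv/= !lte_fin ltr_pM2l//.
  case: ifP => _; last by rewrite mule0.
  by rewrite -!EFinB -EFinM; congr EFin; field.
apply/seteqP; split => x /=;
  by rewrite !in_itv/= /half ltr_pdivlMr// ler_pdivrMr// !(mulrC 2%R).
Qed.

Lemma ge0_integral_half (f : R -> \bar R) : measurable_fun setT f ->
  (forall x, 0 <= f x) ->
  \int[lebesgue_measure]_x f x =
  (2^-1)%:E * \int[lebesgue_measure]_x f (x / 2)%R.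
Proof.
move=> mf f0.
rewrite (eq_measure_integral (mscale ((2^-1)%:nng)%R push)).
  rewrite ge0_integral_mscale//=; congr (_ * _).
  by rewrite ge0_integral_pushforward.
by move=> A mA _; exact: lebesgue_measure_half.
Qed.

(** Concavity at the midpoint of [0] and [x] bounds [psi x / 2] by
    [psi (x / 2) - psi 0 / 2], whose exponential is integrable by rescaling. *)
Lemma SC0_integral_half psi : SC0 psi ->
  \int[lebesgue_measure]_x expeR (psi x) < +oo ->
  \int[lebesgue_measure]_x expeR ((2^-1)%:E * psi x) < +oo.
Proof.
move=> Spsi Ioo; have m := expeR_SC0_measurable Spsi.
have p0 := SC0_fin0 Spsi.
have [[psic _ _ _] _ _] := Spsi.
set p := fine (psi 0%R); pose k : R := expR (- (p / 2)).
have le x : expeR ((2^-1)%:E * psi x) <= k%:E * expeR (psi (x / 2)%R).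
  rewrite -[k%:E]/(expeR (- (p / 2))%:E) -expeRD lee_expeR.
  rewrite addeC EFinN leeBrDr//.
  have := psic x 0%R 2^-1%R; rewrite -(fineK p0) -/p => h.
  have -> : (p / 2)%R = ((1 - 2^-1) * p)%R by field.
  rewrite EFinM; apply: le_trans.
    by apply: h; rewrite invr_ge0 ler0n invf_le1 ?ler1n.
  by rewrite mulr0 addr0 mulrC.
have mhalfe : measurable_fun setT (fun x : R => expeR (psi (x / 2)%R)).
  exact: (measurableT_comp m mhalf).
apply: (@le_lt_trans _ _
  (\int[lebesgue_measure]_x (k%:E * expeR (psi (x / 2)%R)))).
  apply: ge0_le_integral => //.
  - by move=> x _; exact: expeR_ge0.
  - apply: measurableT_comp; first exact: measurable_expeR.
    by apply: measurable_funeM; exact: SC0_measurable.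
  - exact: measurable_funeM.
rewrite ge0_integralZl//; last 2 first.
  - by move=> x _; exact: expeR_ge0.
  - by rewrite lee_fin expR_ge0.
apply: pmule_lty; first exact: expR_ge0.
have := ge0_integral_half m (fun x => expeR_ge0 (psi x)).
move: Ioo => /[swap] ->; case: (X in _ * X) => [r| |]; rewrite ?ltry//.
by rewrite gt0_muley ?lte_fin// ltxx.
Qed.

End symmetric_concave.

(** * The two Stieltjes measures *)

Section stieltjes.
Local Open Scope ereal_scope.
Context (R : realType).

Lemma lebesgue_stieltjes_measure_eq (F : cumulative R R)
    (mu : {measure set (measurableTypeR R) -> \bar R}) :
    (forall a b : R, (a <= b)%R -> mu `]a, b]%classic = (F b - F a)%:E) ->
  forall A, measurable A -> lebesgue_stieltjes_measure F A = mu A.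
Proof.
move=> muF; apply: lebesgue_stieltjes_measure_unique => _ [[a b]] _ <- /=.
rewrite /lebesgue_stieltjes_measure /measure_extension/=.
rewrite measurable_mu_extE/=; last exact: is_ocitv.
have [ab|ba] := leP a b; first by rewrite wlength_itv_bnd// muF.
by rewrite set_itv_ge ?wlength0 ?measure0// bnd_simp -leNgt ltW.
Qed.

End stieltjes.

Section empirical.
Local Open Scope ereal_scope.
Context (R : realType) (n : nat) (X : 'I_n -> R).

(* Sums of measures are indexed by nat: the sample is extended by 0. *)
Let Y (k : nat) : measurableTypeR R := oapp X 0%R (insub k).

Let YE (i : 'I_n) : Y i = X i.
Proof. by rewrite /Y valK. Qed.

Let emp : {measure set (measurableTypeR R) -> \bar R} :=
  mscale (n%:R^-1%:nng)%R (msum (fun k => \d_(Y k)) n).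

Let edf_measure (A : set R) : measurable A ->
  lebesgue_stieltjes_measure (edf X) A = emp A.
Proof.
apply: lebesgue_stieltjes_measure_eq => a b ab.
rewrite /emp/= /mscale/= /msum /edf/= -mulrBr EFinM; congr (_ * _).
rewrite -sumrB -sumEFin; apply: eq_bigr => i _.
rewrite YE diracE !indicE !mem_setE !in_itv/=.
have [Xa|aX] := leP (X i) a.
  by rewrite (le_trans Xa ab) subrr.
by rewrite subr0.
Qed.

Let ge0_integral_edf (f : R -> \bar R) :
  measurable_fun setT f -> (forall x, 0 <= f x) ->
  \int[lebesgue_stieltjes_measure (edf X)]_x f x =
  (n%:R^-1)%:E * \sum_(i < n) f (X i).
Proof.
move=> mf f0; rewrite (eq_measure_integral emp); last first.
  by move=> A mA _; exact: edf_measure.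
rewrite ge0_integral_mscale//= ge0_integral_measure_sum//; congr (_ * _).
apply: eq_bigr => i _; rewrite integral_dirac//= diracT mul1e.
by rewrite YE.
Qed.

(** The terms [f (X i)] may be [-oo]. *)
Lemma integral_edf (f : R -> \bar R) : measurable_fun setT f ->
  (forall i, f (X i) < +oo) ->
  \int[lebesgue_stieltjes_measure (edf X)]_x f x =
  (n%:R^-1)%:E * \sum_(i < n) f (X i).
Proof.
move=> mf foo; rewrite integralE !ge0_integral_edf//; last 2 first.
- exact: measurable_funeneg.
- exact: measurable_funepos.
have pfin : \sum_(i < n) f^\+ (X i) \is a fin_num.
  apply/sum_fin_numP => i _ _; rewrite ge0_fin_numE// funeposE.
  by rewrite gt_max foo ltry.
rewrite -muleBr//; last by rewrite fin_num_adde_defr.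
congr (_ * _).
rewrite -sumeN; last first.
  by move=> i j _ _; apply: ge0_adde_def; rewrite inE funeneg_ge0.
rewrite -big_split/=; apply: eq_bigr => i _.
by rewrite [in RHS](funeposneg f).
Qed.

Lemma edf_notin (D : set R) : measurable D -> (forall i, D (X i)) ->
  lebesgue_stieltjes_measure (edf X) (~` D) = 0.
Proof.
move=> mD DX; rewrite edf_measure//; last exact: measurableC.
rewrite /emp/= /mscale/= /msum big1 ?mule0// => i _.
rewrite /= YE diracE memNset//=; apply; exact: DX.
Qed.

End empirical.

Section slc0.
Local Open Scope ereal_scope.
Context (R : realType) (psi g : R -> \bar R).
Hypotheses (g_psi : g = (fun y => expeR (psi y))) (hg : SLC0 g).
Local Notation leb := (@lebesgue_measure R).

(** The exponential is injective on extended reals, so [psi] is itself a witness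
    of the membership of [g]. *)
Lemma SLC0_SC0 : SC0 psi /\ \int[leb]_x expeR (psi x) = 1.
Proof.
case: hg => phi [Sphi phi1]; rewrite g_psi => phipsi.
suff -> : psi = phi by [].
apply/funext => x; apply: expeR_inj.
by rewrite -[LHS](congr1 (fun h => h x) phipsi).
Qed.

Let g_ge0 x : 0 <= g x. Proof. by rewrite g_psi expeR_ge0. Qed.

Let mg : measurable_fun [set: measurableTypeR R] g.
Proof. by rewrite g_psi; apply: expeR_SC0_measurable; case: SLC0_SC0. Qed.

Let nu (A : set (measurableTypeR R)) := \int[leb]_(y in A) g y.

Let nu0 : nu set0 = 0. Proof. exact: integral_set0. Qed.
Let nu_ge0 A : 0 <= nu A. Proof. exact: integral_ge0. Qed.
Let nu_sigma_additive : semi_sigma_additive nu.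
Proof. exact: semi_sigma_additive_nng_induced. Qed.

#[local] HB.instance Definition _ :=
  isMeasure.Build _ _ _ nu nu0 nu_ge0 nu_sigma_additive.

Let nuT : nu setT = 1.
Proof. by rewrite /nu g_psi; case: SLC0_SC0. Qed.

Lemma slc0_measureE (A : set (measurableTypeR R)) : measurable A ->
  lebesgue_stieltjes_measure (slc0_df hg) A = \int[leb]_(y in A) g y.
Proof.
move: A; apply: (lebesgue_stieltjes_measure_eq (mu := nu)) => a b ab.
have fin A : measurable A -> nu A \is a fin_num.
  move=> mA; rewrite ge0_fin_numE//.
  apply: (@le_lt_trans _ _ 1); last exact: ltry.
  by rewrite -nuT; apply: ge0_subset_integral.
rewrite /slc0_df EFinB !fineK ?(fin _ (measurable_itv _))//.
rewrite -/(nu `]-oo, b]%classic) -/(nu `]-oo, a]%classic).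
have : `]a, b]%classic = `]-oo, b] `\` `]-oo, a] :> set R => [|->].
  by rewrite -[RHS]setCK setCD setCitvl setUC -[LHS]setCK setCitv.
rewrite measureD ?setIidr//; first exact: subset_itvl.
by rewrite -ge0_fin_numE// fin.
Qed.

Lemma slc0_measureT : lebesgue_stieltjes_measure (slc0_df hg) setT = 1.
Proof. by rewrite slc0_measureE// nuT. Qed.

Lemma slc0_measure_Ny :
  lebesgue_stieltjes_measure (slc0_df hg) [set x | psi x = -oo] = 0.
Proof.
rewrite slc0_measureE; last exact: SC0_measurable_Ny SLC0_SC0.1.
by apply: integral0_eq => x /= xoo; rewrite g_psi xoo.
Qed.

Lemma ge0_integral_slc0 (f : R -> \bar R) : measurable_fun setT f ->
  (forall x, 0 <= f x) ->
  \int[lebesgue_stieltjes_measure (slc0_df hg)]_x f x =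
  \int[leb]_x (f x * g x).
Proof.
move=> mf f0; apply: ge0_integral_density => //.
- move=> x; rewrite g_psi; have := SC0_lty x SLC0_SC0.1.
  by case: (psi x).
- exact: slc0_measureE.
Qed.

End slc0.

(** * The criterion and its maximizers *)

Section criterion.
Local Open Scope ereal_scope.
Context (R : realType) (n : nat) (X : 'I_n -> R).
Implicit Types phi : R -> \bar R.
Local Notation leb := (@lebesgue_measure R).

Lemma Psi_fin phi (p : 'I_n -> R) : (forall i, phi (X i) = (p i)%:E) ->
  Psi X phi = (n%:R^-1 * \sum_(i < n) p i)%:E - \int[leb]_x expeR (phi x).
Proof.
move=> phip; rewrite /Psi EFinM -sumEFin; congr (_ * _ - _).
by apply: eq_bigr => i _; rewrite phip.
Qed.

Lemma Psi_eqNy phi i : SC0 phi -> phi (X i) = -oo -> Psi X phi = -oo.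
Proof.
move=> Sphi phiNy; rewrite /Psi.
have n0 : (0 < n%:R :> R)%R by rewrite ltr0n; case: (n) i {phiNy} => // -[].
have -> : \sum_(i < n) phi (X i) = -oo.
  by apply/esum_eqNyP; exists i; rewrite mem_index_enum phiNy.
by rewrite gt0_muleNy ?lte_fin ?invr_gt0// addNye.
Qed.

Lemma Psi_indic_gtNy (M : R) : (0 <= M)%R -> (forall i, `|X i| <= M)%R ->
  -oo < Psi X (fun x : R => if (`|x| <= M)%R then 0 else -oo).
Proof.
move=> M0 XM; rewrite (Psi_fin (p := fun=> 0%R)); last by move=> i; rewrite XM.
rewrite (eq_integral (fun x : measurableTypeR R =>
    (\1_(`[(- M)%R, M]%classic : set R) x)%:E)); last first.
  move=> x _; rewrite indicE mem_setE in_itv/= -ler_norml.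
  by case: ifP; rewrite /= ?expR0.
have Lfin : leb `[(- M)%R, M]%classic \is a fin_num.
  by rewrite lebesgue_measure_itv/=; case: ifP.
by rewrite integral_indic// setIT -[X in _ - X]/(leb _) -(fineK Lfin) ltNyr.
Qed.

End criterion.

Section characterization.
Local Open Scope ereal_scope.
Context (R : realType) (n : nat) (n_gt0 : (0 < n)%N) (X : 'I_n -> R).
Context (psi g : R -> \bar R) (g_psi : g = (fun y => expeR (psi y))).
Context (hg : SLC0 g).
Local Notation leb := (@lebesgue_measure R).
Local Notation m := (lebesgue_stieltjes_measure (edf X)).
Local Notation nu := (lebesgue_stieltjes_measure (slc0_df hg)).

Let Spsi : SC0 psi := (SLC0_SC0 g_psi hg).1.
Let psi1 : \int[leb]_x expeR (psi x) = 1 := (SLC0_SC0 g_psi hg).2.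
Let n_pos : (0 < n%:R :> R)%R. Proof. by rewrite ltr0n. Qed.

(* The effective domain of psi. *)
Let D : set R := [set x | psi x != -oo].

Let psiE x : D x -> psi x = (fine (psi x))%:E.
Proof.
by move=> /= Dx; rewrite fineK// fin_numE Dx -ltey (SC0_lty x Spsi).
Qed.

Let DC : ~` D = [set x | psi x = -oo].
Proof.
apply/seteqP; split => x; rewrite /D/=; first by move=> /negP/negPn/eqP.
by move=> ->; rewrite eqxx.
Qed.

Let mD : measurable D.
Proof.
by rewrite -[D]setCK DC; apply: measurableC; exact: SC0_measurable_Ny.
Qed.

Let nuD : nu (~` D) = 0.
Proof. by rewrite DC slc0_measure_Ny. Qed.

Let integral_expeR_nu (Delta : R -> \bar R) : measurable_fun setT Delta ->
  \int[nu]_x expeR (Delta x) = \int[leb]_x expeR (psi x + Delta x).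
Proof.
move=> mDelta; rewrite (ge0_integral_slc0 g_psi); last 2 first.
- by apply: measurableT_comp mDelta; exact: measurable_expeR.
- by move=> x; exact: expeR_ge0.
by apply: eq_integral => x _; rewrite g_psi -expeRD addeC.
Qed.

(** Otherwise the criterion at [psi] would be [-oo], and the log-indicator of an
    interval containing the sample would do better. *)
Lemma MLE_finite i : (forall phi, SC0 phi -> Psi X phi <= Psi X psi) ->
  psi (X i) \is a fin_num.
Proof.
move=> psimax; rewrite fin_numE -ltey (SC0_lty _ Spsi) andbT.
pose M : R := (\sum_i `|X i|)%R.
have M0 : (0 <= M)%R by apply: sumr_ge0.
have XM j : (`|X j| <= M)%R.
  by rewrite /M (bigD1 j)//= lerDl; apply: sumr_ge0.
apply/eqP => /(Psi_eqNy Spsi) PsiNy.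
have := lt_le_trans (Psi_indic_gtNy M0 XM) (psimax _ (SC0_indic M0)).
by rewrite PsiNy ltxx.
Qed.

Section necessity.
Variables (Delta : R -> \bar R) (t : R).
Hypotheses (Doo : forall y, Delta y < +oo) (t_gt0 : (0 < t)%R).
Hypothesis Schi : SC0 (fun y => psi y + t%:E * Delta y).
Hypothesis psimax : forall phi, SC0 phi -> Psi X phi <= Psi X psi.

Let chi y := psi y + t%:E * Delta y.
Let DD := Delta \_ D.

Let DDoo y : DD y < +oo.
Proof. by rewrite /DD patchE; case: ifP => // _; rewrite ltry. Qed.

Let DX i : D (X i).
Proof. by have := MLE_finite i psimax; rewrite fin_numE => /andP[]. Qed.

Let mDD : measurable_fun setT DD.
Proof.
have -> : DD = (fun x => (t^-1)%:E * (chi x - psi x)) \_ D.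
  apply/funext => x; rewrite /DD !patchE; case: ifPn => // /set_mem Dx.
  rewrite /chi (psiE Dx); case: (Delta x) (Doo x) => [r| |]//= _.
    by congr EFin; field; rewrite gt_eqF.
  by rewrite !(gt0_muleNy, addeNy, addNye) ?lte_fin ?invr_gt0.
apply: (measurable_restrictT _ _).1 => //; apply: measurable_funTS.
apply: measurable_funeM; apply: emeasurable_funB; exact: SC0_measurable.
Qed.

(* The path from psi to chi, in the parameter s; both sides are -oo outside the
   effective domain of psi. *)
Let mixE s x : (0 < s < t)%R ->
  psi x + s%:E * DD x = (1 - s / t)%:E * psi x + (s / t)%:E * chi x.
Proof.
move=> /andP[s0 st]; have st0 : (0 < s / t)%R by rewrite divr_gt0.
have st1 : (0 < 1 - s / t)%R by rewrite subr_gt0 ltr_pdivrMr// mul1r.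
have [psiNy|Dx] := eqVneq (psi x) -oo.
  by rewrite /chi psiNy !(gt0_muleNy, addNye) ?lte_fin.
rewrite /chi /DD patchE mem_set// (psiE Dx).
case: (Delta x) (Doo x) => [r| |]//= _.
  by congr EFin; field; rewrite gt_eqF.
by rewrite !(gt0_muleNy, addeNy) ?lte_fin.
Qed.

Let Smix s : (0 < s < t)%R -> SC0 (fun x => psi x + s%:E * DD x).
Proof.
move=> st; under eq_fun do rewrite mixE//.
apply: SC0_mix => //; move/andP: st => [s0 st].
by rewrite divr_gt0//= ltr_pdivrMr// mul1r.
Qed.

(* chi itself may have an infinite integral (it can be constant), but half-way
   to chi the exponent is at most (psi + chi 0) / 2. *)
Let s0fin : \int[nu]_x expeR ((t / 2)%:E * DD x) < +oo.
Proof.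
rewrite integral_expeR_nu; last exact: measurable_funeM.
have chi0 := SC0_fin0 Schi; set c := fine (chi 0%R).
have Ihalf : \int[leb]_x expeR ((2^-1)%:E * psi x) < +oo.
  by apply: SC0_integral_half => //; rewrite psi1 ltry.
have st : (0 < t / 2 < t)%R.
  by rewrite divr_gt0//= ltr_pdivrMr// ltr_pMr// ltr1n.
have mhalf : measurable_fun setT (fun x => expeR ((2^-1)%:E * psi x)).
  apply: measurableT_comp; first exact: measurable_expeR.
  by apply: measurable_funeM; exact: SC0_measurable.
apply: (@le_lt_trans _ _
  (\int[leb]_x ((expR (c / 2))%:E * expeR ((2^-1)%:E * psi x)))).
  apply: ge0_le_integral => //.
  - by move=> x _; exact: expeR_ge0.
  - by apply: expeR_SC0_measurable; exact: Smix.
  - exact: measurable_funeM.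
  - move=> x _; rewrite -[(expR (c / 2))%:E]/(expeR (c / 2)%:E) -expeRD.
    rewrite lee_expeR mixE// addeC (_ : t / 2 / t = 2^-1)%R; last first.
      by field; rewrite gt_eqF.
    rewrite (_ : 1 - 2^-1 = 2^-1 :> R)%R; last by field.
    rewrite leeD2r// (mulrC c) EFinM fineK// lee_pmul2l ?lte_fin ?invr_gt0//.
    by case: Schi => _ chi0_max _; exact: chi0_max.
rewrite ge0_integralZl//; last by move=> x _; exact: expeR_ge0.
by apply: pmule_lty => //; exact: expR_ge0.
Qed.

(** Maximality along the path [psi + s * Delta] reads
    [1 + s * \int Delta dFn <= \int expeR (s * Delta) dG]; differentiate
    at [s = 0]. *)
Lemma MLE_necessary : \int[m]_y Delta y <= \int[nu]_y Delta y.
Proof.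
have conull (mu : {measure set (measurableTypeR R) -> \bar R}) :
    mu (~` D) = 0 -> \int[mu]_y Delta y = \int[mu]_y DD y.
  exact: (@integral_conull _ (measurableTypeR R)).
rewrite (conull _ nuD) (conull _ (edf_notin mD DX)) integral_edf//.
have [[i DDi]|] := pselect (exists i, DD (X i) = -oo).
  have -> : \sum_(i < n) DD (X i) = -oo.
    by apply/esum_eqNyP; exists i; rewrite mem_index_enum DDi.
  by rewrite gt0_muleNy ?lte_fin ?invr_gt0// leNye.
move=> /forallNP DDfin.
have DDE i : DD (X i) = (fine (DD (X i)))%:E.
  by rewrite fineK// fin_numE -ltey DDoo andbT; apply/eqP.
under eq_bigr do rewrite DDE.
rewrite sumEFin -EFinM.
apply: (exp_moment_derivative (T := measurableTypeR R)
  (slc0_measureT g_psi hg) mDD DDoo _ s0fin); first by rewrite divr_gt0.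
move=> s /andP[s0 st2].
have st : (0 < s < t)%R.
  by rewrite s0/= (le_lt_trans st2)// ltr_pdivrMr// ltr_pMr// ltr1n.
rewrite integral_expeR_nu; last exact: measurable_funeM.
have := psimax (Smix st).
rewrite (Psi_fin
  (p := fun i => fine (psi (X i)) + s * fine (DD (X i)))%R); last first.
  by move=> i; rewrite [in LHS]DDE (psiE (DX i)).
rewrite (Psi_fin (p := fun i => fine (psi (X i)))); last first.
  by move=> i; rewrite -psiE.
rewrite psi1 big_split/= -mulr_sumr.
have : 0 <= \int[leb]_x expeR (psi x + s%:E * DD x).
  by apply: integral_ge0 => x _; exact: expeR_ge0.
case: (\int[leb]_x expeR (psi x + s%:E * DD x)) => [I| |]// _; last first.
  by rewrite leey.
rewrite -!EFinB -EFinD !lee_fin mulrDr mulrCA; lra.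
Qed.

End necessity.

Section sufficiency.
Hypothesis H : forall Delta : R -> \bar R, (forall y, Delta y < +oo) ->
  (exists2 t : R, (0 < t)%R & SC0 (fun y => psi y + t%:E * Delta y)) ->
  \int[m]_y Delta y <= \int[nu]_y Delta y.

(* The indicator of the set where psi = -oo leaves psi unchanged, and is null
   for G; the hypothesis then forbids observations in that set. *)
Let DX i : D (X i).
Proof.
apply/negP => /eqP psiNy.
pose Delta x : \bar R := (\1_(~` D) x)%:E.
have mDelta : measurable_fun setT Delta.
  by apply/measurable_EFinP; apply: measurable_indic; exact: measurableC.
have : \int[m]_y Delta y <= \int[nu]_y Delta y.
  apply: H => [y|]; first by rewrite ltry.
  exists 1%R => //; rewrite (_ : (fun _ => _) = psi)//; apply/funext => y.
  rewrite mul1e /Delta indicE DC; case: (boolP (_ \in _)); last first.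
    by rewrite adde0.
  by move=> /set_mem /= ->; rewrite addNye.
rewrite integral_edf//; last by move=> j; rewrite ltry.
rewrite [leRHS](_ : _ = 0); last first.
  rewrite integral_indic//; last exact: measurableC.
  by rewrite setIT; exact: nuD.
rewrite leNgt => /negP; apply.
rewrite mule_gt0 ?lte_fin ?invr_gt0//.
rewrite /Delta sumEFin lte_fin (bigD1 i)//=.
rewrite ltr_pwDl ?sumr_ge0// indicE mem_set//.
by rewrite DC.
Qed.

(** With [Delta = phi - psi], the tangent inequality turns the hypothesis into
    [\int phi - psi dFn <= \int expeR phi - 1]. *)
Lemma MLE_sufficient phi : SC0 phi -> Psi X phi <= Psi X psi.
Proof.
move=> Sphi.
have [[i phiNy]|/forallNP phifin] := pselect (exists i, phi (X i) = -oo).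
  by rewrite (Psi_eqNy Sphi phiNy) leNye.
have phiE i : phi (X i) = (fine (phi (X i)))%:E.
  by rewrite fineK// fin_numE -ltey (SC0_lty _ Sphi) andbT; apply/eqP.
have philt x := SC0_lty x Sphi.
pose Delta x := if psi x == -oo then 0 else phi x - psi x.
have mDelta : measurable_fun setT Delta.
  apply: measurable_fun_ifT => //.
    by apply: measurable_fun_eqe => //; exact: SC0_measurable.
  by apply: emeasurable_funB; exact: SC0_measurable.
have Dlt x : Delta x < +oo.
  rewrite /Delta; case: ifPn => [|Dx]; first by rewrite ltry.
  by rewrite (psiE Dx) lte_add_pinfty// -EFinN ltry.
have : \int[m]_y Delta y <= \int[nu]_y Delta y.
  (* The step 1 would give phi cut off at the effective domain of psi, which
     need not be closed; the step 1/2 gives a mixture. *)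
  apply: H => //; exists (2^-1)%R; first by rewrite invr_gt0.
  rewrite (_ : (fun _ => _) =
      fun x => (1 - 2^-1)%:E * psi x + (2^-1)%:E * phi x).
    by apply: SC0_mix => //; rewrite invr_gt0 ltr0n invf_lt1 ?ltr1n.
  have h0 : (0 < 1 - 2^-1 :> R)%R by lra.
  apply/funext => x; rewrite /Delta; case: ifPn => [/eqP ->|Dx].
    by rewrite mule0 addNye gt0_muleNy ?lte_fin// addNye.
  rewrite (psiE Dx); case: (phi x) (philt x) => [r| |]//= _.
    by congr EFin; field.
  by rewrite !(gt0_muleNy, addeNy, addNye) ?lte_fin ?invr_gt0.
rewrite integral_edf//.
move=> /le_trans/(_ (integral_le_expeR (slc0_measureT g_psi hg) mDelta)).
rewrite integral_expeR_nu//.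
have : \int[leb]_x expeR (psi x + Delta x) <= \int[leb]_x expeR (phi x).
  apply: ge0_le_integral => //.
  - by move=> x _; exact: expeR_ge0.
  - apply: measurableT_comp; first exact: measurable_expeR.
    by apply: emeasurable_funD => //; exact: SC0_measurable.
  - exact: expeR_SC0_measurable.
  - move=> x _; rewrite lee_expeR /Delta; case: ifPn => [/eqP ->|Dx].
      by rewrite addNye leNye.
    by rewrite (psiE Dx) addeC subeK.
set J := (X in _ <= X -> _); set I := (X in X <= _ -> _).
move=> IJ IH; have {IH} : (n%:R^-1)%:E * \sum_(i < n) Delta (X i) <= J - 1.
  by apply: (le_trans IH); rewrite leeB.
rewrite (eq_bigr
  (fun i => (fine (phi (X i)) - fine (psi (X i)))%:E)); last first.
  move=> i _; rewrite /Delta (negbTE (DX i)).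
  by rewrite {1}phiE (psiE (DX i)) -EFinB.
rewrite sumEFin -EFinM (Psi_fin phiE) (Psi_fin (fun i => psiE (DX i))) psi1 -/J.
have : 0 <= J by apply: integral_ge0 => x _; exact: expeR_ge0.
case: J {IJ} => [r| |]// _; last by rewrite addeNy leNye.
by rewrite -!EFinB !lee_fin sumrB mulrBr; lra.
Qed.

End sufficiency.

End characterization.

Theorem theorem2p2 (R : realType) (d : measure_display) (T : measurableType d)
    (P : probability T R) (n : nat) (n_gt0 : (0 < n)%N)
    (X : 'I_n -> {RV P >-> R}) (f : R -> R) (X_iid : iid_with_density X f)
    (omega : T) (psi g : R -> \bar R)
    (g_psi : g = (fun y => expeR (psi y))) (hg : SLC0 g) :
  is_MLE0 (fun i => X i omega) g <->
  (forall Delta : R -> \bar R, (forall y, (Delta y < +oo)%E) ->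
     (exists2 t : R, 0 < t & SC0 (fun y => psi y + t%:E * Delta y)%E) ->
     (\int[lebesgue_stieltjes_measure (edf (fun i => X i omega))]_y Delta y
      <= \int[lebesgue_stieltjes_measure (slc0_df hg)]_y Delta y)%E).
Proof.
split.
  move=> [psi' [_ psimax g_psi']] Delta Delta_lty [t t_gt0 Sp].
  apply: (MLE_necessary (X := fun i => X i omega) n_gt0 g_psi hg
    Delta_lty t_gt0 Sp).
  suff -> : psi = psi' by [].
  apply/funext => x; apply: expeR_inj.
  by rewrite -[LHS](congr1 (fun h => h x) g_psi) g_psi'.
move=> H; exists psi; split => //; first exact: (SLC0_SC0 g_psi hg).1.
exact: (MLE_sufficient n_gt0 g_psi).
Qed.
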